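(* Let $Q=[0,1]^3$, let $F:Q\to\mathbb R^3$ be a trilinear map, and let $J=\det(DF)$ be its Jacobian determinant. If $J(p)>0$ for every $p\in\partial Q$, then $J(p)>0$ for every $p\in Q$; that is, the hexahedron $\mathcal H=F(Q)$ is valid.
   Context: Reference coordinates on $Q=[0,1]^3$ are $(x,y,z)$. A map $F:Q\to\mathbb R^3$ is trilinear if it is affine in each of $x,y,z$ separately, i.e. $F(x,y,z)=\sum_{i,j,k\in\{0,1\}}c_{ijk}x^iy^jz^k$ with $c_{ijk}\in\mathbb R^3$. $DF=[\partial F/\partial x\mid\partial F/\partial y\mid\partial F/\partial z]$ is the $3\times3$ Jacobian matrix and $J=\det(DF)$, a polynomial in $(x,y,z)$. $\partial Q$ is the boundary of the cube (the union of its six closed faces). The hexahedron $\mathcal H=F(Q)$ with map $F$ is called valid if and only if $J(p)>0$ for all $p\in Q$. *)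

(* Defs.v *)
From HB Require Import structures.
From mathcomp Require Import all_boot all_order all_algebra.
From mathcomp Require Import all_classical all_reals all_analysis.

Set Implicit Arguments.
Unset Strict Implicit.
Unset Printing Implicit Defensive.

Import Order.TTheory GRing.Theory Num.Theory.
Import numFieldNormedType.Exports.

Local Open Scope classical_set_scope.
Local Open Scope ring_scope.

(* Points and values are row vectors of R^3; the coordinates (x, y, z) of p
   are p 0 0, p 0 1, p 0 2. *)

Definition cube (R : realType) : set 'rV[R]_3 :=
  [set p | forall i, 0 <= p 0 i <= 1].

(* The union of the six closed faces {p_i = a}, i < 3, a = 0 or 1. *)
Definition cube_boundary (R : realType) : set 'rV[R]_3 :=
  [set p | cube p /\ exists i, p 0 i = 0 \/ p 0 i = 1].

(* A trilinear map on the cube is identified with its polynomial extension to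
   R^3 (it is unique), so that its derivatives also make sense on the boundary
   of the cube. *)
Definition trilinear (R : realType) (F : 'rV[R]_3 -> 'rV[R]_3) : Prop :=
  exists c : 'I_2 -> 'I_2 -> 'I_2 -> 'rV[R]_3, forall p : 'rV[R]_3,
    F p = \sum_(i < 2) \sum_(j < 2) \sum_(k < 2)
            (p 0 0 ^+ i * p 0 1 ^+ j * p 0 2 ^+ k) *: c i j k.

(* With the row-vector convention of the library, row j of 'J F p is the partial
   derivative of F along the j-th axis; transposing makes it column j. *)
Definition DF (R : realType) (F : 'rV[R]_3 -> 'rV[R]_3) (p : 'rV[R]_3) :
  'M[R]_3 := ('J F p)^T.

Definition Jdet (R : realType) (F : 'rV[R]_3 -> 'rV[R]_3) (p : 'rV[R]_3) : R :=
  \det (DF F p).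

(* Validity of the hexahedron F @` cube, which depends on the map F and not
   only on its image. *)
Definition valid_hexahedron (R : realType) (F : 'rV[R]_3 -> 'rV[R]_3) : Prop :=
  forall p, cube p -> 0 < Jdet F p.

(* Main.v *)
Require Import Defs.
From mathcomp Require Import all_boot all_order all_algebra.
From mathcomp Require Import all_classical all_reals all_analysis.
From mathcomp Require Import ring lra.

(* At a fixed y, the slice of the image is a bilinear patch, planar exactly when
   the volume tau_y(y) = det(F_z, F_x, F_xz) vanishes (it does not depend on x
   and z).  On a planar slice the Jacobian J is, up to a positive factor, a
   product of an affine and a bilinear function of (x, z); being positive on the
   boundary of the square, it is positive on the whole square.

   So if J(p) <= 0, the numbers tau_x, tau_y, tau_z do not vanish at p, and two
   of them have the same sign, say tau_y tau_z > 0.  With z fixed, consider the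
   points (x, y) of the square where J <= 0 and tau_y tau_z >= 0, and choose one
   with y maximal.  Then J(., y, z) is nonnegative on [0, 1] and vanishes at an
   interior point, so J_x = 0 there.  With P = det(F_x, F_xy, F_z) and
   Q = det(F_x, F_y, F_xz), one has J_x = P + Q, and a Pluecker relation gives
   P Q = J det(F_x, F_xy, F_xz) + tau_y tau_z.  Hence - P^2 = tau_y tau_z > 0,
   which is absurd. *)

Local Open Scope ring_scope.

Import Order.TTheory GRing.Theory Num.Theory.
Import numFieldNormedType.Exports.

Section Algebra.
Set Implicit Arguments.
Unset Strict Implicit.
Unset Printing Implicit Defensive.
Context {R : realFieldType}.
Implicit Types u v w : 'rV[R]_3.

(** * Triple products of vectors in three-space *)

Definition triple u v w : R :=
  u 0 0 * (v 0 1 * w 0 2 - v 0 2 * w 0 1)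
  + u 0 1 * (v 0 2 * w 0 0 - v 0 0 * w 0 2)
  + u 0 2 * (v 0 0 * w 0 1 - v 0 1 * w 0 0).

Definition cross u v : 'rV[R]_3 := \row_j
  (if j == 0 then u 0 1 * v 0 2 - u 0 2 * v 0 1
   else if j == 1 then u 0 2 * v 0 0 - u 0 0 * v 0 2
   else u 0 0 * v 0 1 - u 0 1 * v 0 0).

Definition dot u v : R := u 0 0 * v 0 0 + u 0 1 * v 0 1 + u 0 2 * v 0 2.

Lemma cross0 u v : cross u v 0 0 = u 0 1 * v 0 2 - u 0 2 * v 0 1.
Proof. by rewrite mxE. Qed.

Lemma cross1 u v : cross u v 0 1 = u 0 2 * v 0 0 - u 0 0 * v 0 2.
Proof. by rewrite mxE. Qed.

Lemma cross2 u v : cross u v 0 2 = u 0 0 * v 0 1 - u 0 1 * v 0 0.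
Proof. by rewrite mxE. Qed.

Definition crossE := (cross0, cross1, cross2).

Lemma det_triple (A : 'M[R]_3) : \det A = triple (row 0 A) (row 1 A) (row 2 A).
Proof.
rewrite (expand_det_row _ 0) !big_ord_recl big_ord0 /cofactor.
rewrite !(expand_det_row _ 0) !big_ord_recl !big_ord0 /cofactor !det_mx11 /triple /=.
rewrite !mxE /=.
(* Indexing the entries by naturals lets the different forms of one ordinal compute to the same
   index, so that [ring] identifies them. *)
pose g (i j : nat) : R := A (inord i) (inord j).
have gE i j : A i j = g i j by rewrite /g !inord_val.
rewrite !gE /= /bump /=; ring.
Qed.

Lemma triple_cyc u v w : triple u v w = triple v w u.
Proof. by rewrite /triple; ring. Qed.

Lemma triple_shear (u v b : 'rV[R]_3) (s t : R) :
  triple (u + s *: b) (v + t *: b) b = triple u v b.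
Proof. by rewrite /triple !mxE; ring. Qed.

(** Modulo [A], the numbers [triple A u v] are the 2x2 minors of four vectors of a plane; this is
    the three-term relation between them. *)
Lemma triple_plucker (A B C b c : 'rV[R]_3) :
  triple A c C * triple A B b
  = triple A B C * triple A c b + triple C A b * triple A B c.
Proof. by rewrite /triple; ring. Qed.

Lemma triple_pencil (A B C b c : 'rV[R]_3) (h : R) :
  triple A (B + h *: c) (C + h *: b)
  = triple A B C + h * (triple A c C + triple A B b) + h ^+ 2 * triple A c b.
Proof. by rewrite /triple !mxE; ring. Qed.

(** * Signs of affine and bilinear factors of a positive product *)

Lemma affine_prod_gt0 (a b c d : R) :
  (forall t : R, 0 <= t <= 1 -> 0 < (a + t * b) * (c + t * d)) -> 0 < a * (a + b).
Proof.
move=> H; rewrite ltNge; apply/negP => ab.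
have a0 : a != 0.
  apply/eqP => a0; have := H 0; rewrite a0 lexx ler01 => /(_ isT).
  by rewrite !mul0r !addr0 mul0r ltxx.
have aa : 0 < a * a by rewrite -expr2 exprn_even_gt0.
have b0 : b != 0 by apply/eqP => b0; move: ab; rewrite b0 addr0 leNgt aa.
have bb : 0 < b * b by rewrite -expr2 exprn_even_gt0.
have e : - a / b = - (a * b) / (b * b) by field.
(* If [a] and [a + b] do not have the same strict sign, the first factor has its root in [0, 1]. *)
suff /H : 0 <= - a / b <= 1 by rewrite divfK // subrr mul0r ltxx.
rewrite e; apply/andP; split; first by rewrite divr_ge0 ?ltW //; lra.
rewrite ler_pdivrMr // mul1r.
by have := sqr_ge0 (a + b); rewrite sqrrD; lra.
Qed.

(** A bilinear function is a convex combination of its four corner values, and the hypotheses carry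
    the sign of [p0] along three edges to every corner. *)
Lemma bilinear_sign (p0 p1 p2 p3 s t : R) :
  0 < p0 * (p0 + p1) -> 0 < p0 * (p0 + p2) ->
  0 < (p0 + p1) * (p0 + p1 + (p2 + p3)) ->
  0 <= s <= 1 -> 0 <= t <= 1 ->
  0 < p0 * (p0 + s * p1 + t * p2 + s * t * p3).
Proof.
move=> h1 h2 h3 /andP[s0 s1] /andP[t0 t1].
have p00 : 0 < p0 ^+ 2.
  by rewrite exprn_even_gt0 //; apply/eqP => p0E; move: h1; rewrite p0E mul0r ltxx.
have p10 : 0 < (p0 + p1) ^+ 2.
  by rewrite exprn_even_gt0 //; apply/eqP => p0E; move: h3; rewrite p0E mul0r ltxx.
have h4 : 0 < p0 * (p0 + p1 + (p2 + p3)).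
  rewrite -(pmulr_lgt0 _ p10).
  suff -> : p0 * (p0 + p1 + (p2 + p3)) * (p0 + p1) ^+ 2
      = p0 * (p0 + p1) * ((p0 + p1) * (p0 + p1 + (p2 + p3))) by exact: mulr_gt0.
  by ring.
have [s' t'] : 0 <= 1 - s /\ 0 <= 1 - t by split; lra.
(* Some weights may vanish, so strictness comes from a common positive lower bound of the corner
   values. *)
set m := Num.min (Num.min (p0 ^+ 2) (p0 * (p0 + p1)))
                 (Num.min (p0 * (p0 + p2)) (p0 * (p0 + p1 + (p2 + p3)))).
have m0 : 0 < m by rewrite !lt_min p00 h1 h2 h4.
have : m <= m by [].
rewrite {2}/m !le_min -!andbA => /and4P[m1 m2 m3 m4].
apply: (lt_le_trans m0).
rewrite (_ : m = (1 - s) * (1 - t) * m + s * (1 - t) * m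
   + (1 - s) * t * m + s * t * m); last by ring.
rewrite (_ : p0 * _ = (1 - s) * (1 - t) * p0 ^+ 2 + s * (1 - t) * (p0 * (p0 + p1))
   + (1 - s) * t * (p0 * (p0 + p2)) + s * t * (p0 * (p0 + p1 + (p2 + p3)))); last by ring.
by rewrite !lerD // ler_wpM2l // mulr_ge0.
Qed.

Lemma bilinear_prod_gt0 (p0 p1 p2 p3 q0 q1 q2 q3 : R) :
  (forall s t : R, 0 <= s <= 1 -> 0 <= t <= 1 ->
     [\/ s = 0, s = 1, t = 0 | t = 1] ->
     0 < (p0 + s * p1 + t * p2 + s * t * p3)
         * (q0 + s * q1 + t * q2 + s * t * q3)) ->
  forall s t : R, 0 <= s <= 1 -> 0 <= t <= 1 ->
     0 < (p0 + s * p1 + t * p2 + s * t * p3)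
         * (q0 + s * q1 + t * q2 + s * t * q3).
Proof.
move=> H s t hs ht.
have z01 : 0 <= (0 : R) <= 1 by rewrite lexx ler01.
have o01 : 0 <= (1 : R) <= 1 by rewrite lexx ler01.
have Et r : 0 <= r <= 1 -> 0 < (p0 + r * p2) * (q0 + r * q2).
  move=> hr; have := H 0 r z01 hr; rewrite !mul0r !addr0; apply.
  exact: Or41.
have Es r : 0 <= r <= 1 -> 0 < (p0 + r * p1) * (q0 + r * q1).
  move=> hr; have := H r 0 hr z01; rewrite !mulr0 !mul0r !addr0; apply.
  exact: Or43.
have Et1 r : 0 <= r <= 1 ->
    0 < (p0 + p1 + r * (p2 + p3)) * (q0 + q1 + r * (q2 + q3)).
  move=> hr; have := H 1 r o01 hr.
  by rewrite !mul1r -!(addrA _ (r * _)) -!mulrDr; apply; exact: Or42.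
have sw (a b c d : R) : (forall r, 0 <= r <= 1 -> 0 < (a + r * b) * (c + r * d)) ->
    forall r, 0 <= r <= 1 -> 0 < (c + r * d) * (a + r * b).
  by move=> h r hr; rewrite mulrC h.
have P := @bilinear_sign p0 p1 p2 p3 s t (affine_prod_gt0 Es)
  (affine_prod_gt0 Et) (affine_prod_gt0 Et1) hs ht.
have Q := @bilinear_sign q0 q1 q2 q3 s t (affine_prod_gt0 (sw _ _ _ _ Es))
  (affine_prod_gt0 (sw _ _ _ _ Et)) (affine_prod_gt0 (sw _ _ _ _ Et1)) hs ht.
have := Et 0 z01; rewrite !mul0r !addr0 => pq.
by have := mulr_gt0 P Q; rewrite mulrACA pmulr_rgt0.
Qed.

(* If [triple A B E = 0], the vectors [A + s E] and [B + t E] stay in a plane, so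
   their cross product is a multiple of [A x B]. *)
Lemma triple_coplanar (A B E V : 'rV[R]_3) (s t : R) :
  triple A B E = 0 ->
  dot (cross A B) (cross A B) * triple V (A + s *: E) (B + t *: E)
  = (dot (cross A B) (cross A B)
       + s * dot (cross E B) (cross A B) + t * dot (cross A E) (cross A B))
    * dot V (cross A B).
Proof.
move=> ABE; apply/eqP; rewrite -subr_eq0; apply/eqP.
(* With [w = A x B] and [X = E x B] or [A x E], one has [|w|^2 X - (X.w) w = w x (X x w)], and
   [X x w] has the factor [triple A B E]. *)
transitivity (triple A B E *
  dot V (cross (cross A B) (s *: B - t *: A))); last by rewrite ABE mul0r.
rewrite /triple /dot !crossE !mxE; ring.
Qed.


(** * The Jacobian polynomial and its planar slices *)

Definition bilin (p q r s : 'rV[R]_3) (t u : R) : 'rV[R]_3 :=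
  p + t *: q + u *: r + (t * u) *: s.

(* The Jacobian determinant of the trilinear map
   const + x a + y b + z c + yz d + xz e + xy f + xyz g. *)
Definition jac (a b c d e f g : 'rV[R]_3) (x y z : R) : R :=
  triple (bilin a f e g y z) (bilin b d f g z x) (bilin c e d g x y).

(* Vanishes when the image of the slice at height [y] is planar. *)
Definition twist (a b c d e f g : 'rV[R]_3) (y : R) : R :=
  triple (c + y *: d) (a + y *: f) (e + y *: g).

(** The vanishing product says that some coordinate is 0 or 1, in a form invariant under rotation of
    the axes and checkable by [ring]. *)
Definition jac_gt0_on_boundary (a b c d e f g : 'rV[R]_3) : Prop :=
  forall x y z : R, 0 <= x <= 1 -> 0 <= y <= 1 -> 0 <= z <= 1 ->
    x * (1 - x) * (y * (1 - y)) * (z * (1 - z)) = 0 ->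
    0 < jac a b c d e f g x y z.

Lemma jac_rot (a b c d e f g : 'rV[R]_3) (x y z : R) :
  jac a b c d e f g x y z = jac b c a e f d g y z x.
Proof. exact: triple_cyc. Qed.

Lemma jac_gt0_on_boundary_rot (a b c d e f g : 'rV[R]_3) :
  jac_gt0_on_boundary a b c d e f g -> jac_gt0_on_boundary b c a e f d g.
Proof.
move=> H y z x hy hz hx h; rewrite -jac_rot; apply: H => //.
by rewrite -h; ring.
Qed.

Lemma jac_gt0_on_planar_slice (a b c d e f g : 'rV[R]_3) (y : R) :
  jac_gt0_on_boundary a b c d e f g -> 0 <= y <= 1 ->
  twist a b c d e f g y = 0 ->
  forall x z : R, 0 <= x <= 1 -> 0 <= z <= 1 -> 0 < jac a b c d e f g x y z.
Proof.
move=> bd hy; rewrite /twist.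
set C := c + y *: d; set A := a + y *: f; set E := e + y *: g => tw.
have jacE x z : jac a b c d e f g x y z
    = triple (bilin b d f g z x) (C + x *: E) (A + z *: E).
  rewrite /jac triple_cyc; congr triple; apply/rowP => i.
    by rewrite !mxE; ring.
  by rewrite !mxE; ring.
set w := cross C A.
(* Positivity of the Jacobian at the corner x = z = 0 of the slice excludes a zero normal. *)
have w0 : 0 < dot w w.
  have : 0 < jac a b c d e f g 0 y 0.
    by apply: bd; rewrite ?lexx ?ler01 //; ring.
  rewrite jacE !scale0r !addr0 /dot -!expr2 => h.
  rewrite lt_neqAle !addr_ge0 ?sqr_ge0 // andbT eq_sym; apply: contraL h.
  rewrite !paddr_eq0 ?addr_ge0 ?sqr_ge0 // !sqrf_eq0 -andbA => /and3P[].
  rewrite !crossE => /eqP h0 /eqP h1 /eqP h2.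
  by rewrite /triple h0 h1 h2 !mulr0 !addr0 ltxx.
(* The affine factor gets a zero [x * z] term to fit [bilinear_prod_gt0]; [h] is the component of
   the y-derivative along [w]. *)
pose n x z := dot w w + x * dot (cross E A) w + z * dot (cross C E) w + x * z * 0.
pose h x z := dot b w + x * dot f w + z * dot d w + x * z * dot g w.
have jacM x z : dot w w * jac a b c d e f g x y z = n x z * h x z.
  rewrite jacE triple_coplanar // -/w /n mulr0 addr0; congr (_ * _).
  by rewrite /h /dot !mxE; ring.
move=> x z hx hz; rewrite -(pmulr_rgt0 _ w0) jacM.
apply: bilinear_prod_gt0 => // s t hs ht hb.
rewrite -[X in 0 < X]/(n s t * h s t) -jacM (pmulr_rgt0 _ w0); apply: bd => //.
by case: hb => ->; rewrite ?(subrr, mul0r, mulr0).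
Qed.

End Algebra.

(** * Compactness and the extremal point *)

Section Analysis.
Set Implicit Arguments.
Unset Strict Implicit.
Unset Printing Implicit Defensive.
Local Open Scope classical_set_scope.
Context {R : realType}.

Lemma highest_nonpos_point (j : R * R -> R) (t : R -> R) (x0 y0 : R) :
  continuous j -> continuous t ->
  0 <= x0 <= 1 -> 0 <= y0 <= 1 -> j (x0, y0) <= 0 -> 0 < t y0 ->
  (forall x, 0 <= x <= 1 -> 0 < j (x, 1)) ->
  (forall x y, 0 <= x <= 1 -> 0 <= y <= 1 -> t y = 0 -> 0 < j (x, y)) ->
  exists x y, [/\ 0 <= x <= 1, 0 <= y <= 1, j (x, y) <= 0, 0 < t y
    & forall x', 0 <= x' <= 1 -> 0 <= j (x', y)].
Proof.
move=> cj ct hx0 hy0 j0 t0 jtop jt.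
(* The condition on [t] is weakened to [0 <= t] to make [K] closed; the hypothesis on zeros of [t]
   restores strictness at the maximum. *)
pose K : set (R * R) := (`[(0 : R), 1] `*` `[(0 : R), 1]) `&` (j @^-1` [set r | r <= 0]
  `&` (t \o snd) @^-1` [set r | 0 <= r]).
have KP q : K q <-> [/\ 0 <= q.1 <= 1, 0 <= q.2 <= 1, j q <= 0 & 0 <= t q.2].
  by rewrite /K /= !in_itv /=; split => [[[? ?] [? ?]]|[]].
have K0 : K !=set0 by exists (x0, y0); apply/KP; split => //; exact: ltW.
have cts : continuous (t \o (snd : R * R -> R)).
  by move=> q; apply: continuous_comp; [exact: cvg_snd|exact: ct].
have Kc : compact K.
  apply: compact_closedI; first by apply: compact_setX; exact: segment_compact.
  apply: closedI; apply: preimage_closed.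
  - by move=> ? _; exact: cj.
  - exact: closed_le.
  - by move=> ? _; exact: cts.
  - exact: closed_ge.
have [|[x y]] := @compact_EVT_max _ R snd K K0 Kc.
  by apply: continuous_subspaceT => q; exact: cvg_snd.
rewrite inE => /KP /= [hx hy jxy ty] ymax.
have ty0 : 0 < t y.
  rewrite lt_neqAle ty andbT eq_sym; apply/eqP => tyE.
  by have := jt x y hx hy tyE; rewrite ltNge jxy.
have y1 : y < 1.
  rewrite lt_neqAle; move/andP: (hy) => [_ ->]; rewrite andbT; apply/eqP => yE.
  by have := jtop x hx; rewrite -yE ltNge jxy.
exists x, y; split => // x' hx'; rewrite leNgt; apply/negP => jneg.
have cjx : {for y, continuous (fun y' => j (x', y'))}.
  apply: (@continuous_comp _ _ _ (fun y' => (x', y')) j); last exact: cj.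
  exact: (@cvg_pair _ _ _ (nbhs y) (nbhs x') (nbhs y) _ _ _ (fun=> x') id (cvg_cst _) cvg_id).
(* By continuity, points [(x', y')] slightly above a negative value still lie in [K], against
   maximality of [y]. *)
near y^'+ => y'.
have yy' : y < y' by near: y'; exact: nbhs_right_gt.
suff : y' <= y by rewrite leNgt yy'.
have /= := ymax (x', y'); apply; rewrite inE; apply/KP; split => //=.
- rewrite (le_trans (andP hy).1 (ltW yy')) /=; near: y'; exact: nbhs_right_le.
- near: y'; apply: (cvgr_le (j (x', y))) => //.
  by apply: cvg_at_right_filter; exact: cjx.
- near: y'; apply: (cvgr_ge (t y)) => //.
  by apply: cvg_at_right_filter; exact: ct.
Unshelve. all: by end_near. Qed.


Lemma continuous_triple (T : topologicalType) (u v w : T -> 'rV[R]_3) :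
  continuous u -> continuous v -> continuous w ->
  continuous (fun x => triple (u x) (v x) (w x)).
Proof.
move=> cu cv cw.
have coord (h : T -> 'rV[R]_3) i : continuous h -> continuous (fun x => h x 0 i).
  move=> ch x; apply: (@continuous_comp _ _ _ h (fun M : 'rV[R]_3 => M 0 i)).
    exact: ch.
  exact: coord_continuous.
have [cui cvi] := (coord u ^~ cu, coord v ^~ cv).
have cwi := coord w ^~ cw.
have term i j k l m : continuous (fun x =>
    u x 0 i * (v x 0 j * w x 0 k - v x 0 l * w x 0 m)).
  move=> x; apply: cvgM; first exact: cui.
  by apply: cvgB; (apply: cvgM; [exact: cvi|exact: cwi]).
by move=> x; apply: cvgD; [apply: cvgD|]; exact: term.
Qed.

Lemma continuous_bilin (T : topologicalType) (p q r s : 'rV[R]_3)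
    (t u : T -> R) :
  continuous t -> continuous u ->
  continuous (fun x => bilin p q r s (t x) (u x)).
Proof.
move=> ct cu x; rewrite /bilin.
apply: cvgD; last by apply: cvgZr_tmp; apply: cvgM; [exact: ct|exact: cu].
apply: cvgD; last by apply: cvgZr_tmp; exact: cu.
by apply: cvgD; [exact: cvg_cst|apply: cvgZr_tmp; exact: ct].
Qed.

Lemma quadratic_ge0_slope (r S L : R) : 0 < r ->
  (forall h, 0 <= h <= r -> 0 <= h * S + h ^+ 2 * L) -> 0 <= S.
Proof.
move=> r0 H; rewrite leNgt; apply/negP => S0.
have L1 : 0 < `|L| + 1 by rewrite ltr_pwDr.
(* This choice gives [S + h * L <= - h < 0]. *)
pose h := Num.min r (- S / (`|L| + 1)).
have h0 : 0 < h by rewrite lt_min r0 divr_gt0 // oppr_gt0.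
have : 0 <= h * S + h ^+ 2 * L by apply: H; rewrite ltW //= ge_min lexx.
rewrite expr2 -mulrA -mulrDr pmulr_rge0 // leNgt => /negP; apply.
have : h * (`|L| + 1) <= - S by rewrite -ler_pdivlMr // ge_min lexx orbT.
have : h * L <= h * `|L| by rewrite ler_pM2l // ler_norm.
lra.
Qed.

(* For fixed [y] and [z], [jac] is a quadratic polynomial in [x] whose
   discriminant is a square plus 4 times this product of twists. *)
Lemma jac_gt0_of_twists (a b c d e f g : 'rV[R]_3) (x y z : R) :
  jac_gt0_on_boundary a b c d e f g ->
  0 <= x <= 1 -> 0 <= y <= 1 -> 0 <= z <= 1 ->
  0 < twist a b c d e f g y * twist b c a e f d g z ->
  0 < jac a b c d e f g x y z.
Proof.
move=> bd hx hy hz tw; rewrite ltNge; apply/negP => J0.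
pose j (q : R * R) := jac a b c d e f g q.1 q.2 z.
pose t y := twist a b c d e f g y * twist b c a e f d g z.
have z01 : 0 <= (0 : R) <= 1 by rewrite lexx ler01.
have o01 : 0 <= (1 : R) <= 1 by rewrite lexx ler01.
have cj : continuous j.
  by apply: continuous_triple; apply: continuous_bilin => q;
    do ?[exact: cvg_cst|exact: cvg_fst|exact: cvg_snd].
have ct : continuous t.
  have cty : continuous (twist a b c d e f g).
    rewrite (_ : twist _ _ _ _ _ _ _ = fun s => triple (bilin c d 0 0 s 0)
        (bilin a f 0 0 s 0) (bilin e g 0 0 s 0)); last first.
      by apply/funext => s; rewrite /twist /bilin !scaler0 !addr0.
    apply: continuous_triple; apply: continuous_bilin => q;
      by [exact: cvg_cst|exact: cvg_id].
  by move=> r; apply: cvgMr_tmp; exact: cty.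
have jtop r : 0 <= r <= 1 -> 0 < j (r, 1).
  by move=> hr; apply: bd => //=; ring.
have jt r s : 0 <= r <= 1 -> 0 <= s <= 1 -> t s = 0 -> 0 < j (r, s).
  move=> hr hs /eqP; rewrite mulf_eq0 => /orP[] /eqP twE.
    exact: (jac_gt0_on_planar_slice bd).
  by move: tw; rewrite twE mulr0 ltxx.
have [x' [y' [hx' hy' jle0 ty' jge0]]] :=
  highest_nonpos_point cj ct hx hy J0 tw jtop jt.
have jE : j (x', y') = 0 by apply/eqP; rewrite eq_le jle0 jge0.
have x'0 : 0 < x'.
  case/andP: (hx') => h _; rewrite lt_neqAle h andbT eq_sym; apply/eqP => xE.
  suff : 0 < j (x', y') by rewrite jE ltxx.
  by apply: bd => //=; rewrite xE; ring.
have x'1 : x' < 1.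
  case/andP: (hx') => _ h; rewrite lt_neqAle h andbT; apply/eqP => xE.
  suff : 0 < j (x', y') by rewrite jE ltxx.
  by apply: bd => //=; rewrite xE; ring.
set A := bilin a f e g y' z; set B := bilin b d f g z x'.
set C := bilin c e d g x' y'.
pose fz := f + z *: g; pose ey := e + y' *: g.
(* [A] does not involve x, while [B] and [C] are affine in it; the coefficient of [h] is the
   x-derivative of the Jacobian. *)
have jh h : j (x' + h, y') = j (x', y') + h * (triple A fz C + triple A B ey)
    + h ^+ 2 * triple A fz ey.
  rewrite /j /jac /= -triple_pencil.
  by congr triple; apply/rowP => i; rewrite !mxE; ring.
(* An interior zero minimum: moving left and moving right bound the slope from both sides. *)
have S0 : triple A fz C + triple A B ey = 0.
  apply/eqP; rewrite eq_le; apply/andP; split.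
    rewrite -oppr_ge0; apply: (@quadratic_ge0_slope x' _ (triple A fz ey)) => //.
    move=> h /andP[h0 hx'']; have := jge0 (x' - h); rewrite jh jE add0r mulNr sqrrN -mulrN.
    by apply; apply/andP; split; lra.
  apply: (@quadratic_ge0_slope (1 - x') _ (triple A fz ey)); first by lra.
  move=> h /andP[h0 hx'']; have := jge0 (x' + h); rewrite jh jE add0r.
  by apply; apply/andP; split; lra.
(* Shearing along [ey] and along [fz] reduces the two determinants to the twists in y and in z. *)
have tE : triple C A ey * triple A B fz = t y'.
  have CE : C = (c + y' *: d) + x' *: ey by apply/rowP => i; rewrite !mxE; ring.
  have AE : A = (a + y' *: f) + z *: ey by apply/rowP => i; rewrite !mxE; ring.
  have AE' : A = (a + z *: e) + y' *: fz by apply/rowP => i; rewrite !mxE; ring.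
  have BE : B = (b + z *: d) + x' *: fz by apply/rowP => i; rewrite !mxE; ring.
  by rewrite {1}AE CE triple_shear AE' BE triple_shear.
have := triple_plucker A B C ey fz.
rewrite tE -[triple A B C]/(j (x', y')) jE mul0r add0r.
move/eqP: S0; rewrite addr_eq0 => /eqP -> tyE.
by move: ty'; rewrite -tyE mulNr oppr_gt0 -expr2 ltNge sqr_ge0.
Qed.

Lemma jac_gt0 (a b c d e f g : 'rV[R]_3) (x y z : R) :
  jac_gt0_on_boundary a b c d e f g ->
  0 <= x <= 1 -> 0 <= y <= 1 -> 0 <= z <= 1 ->
  0 < jac a b c d e f g x y z.
Proof.
move=> bd hx hy hz.
have bd1 := jac_gt0_on_boundary_rot bd; have bd2 := jac_gt0_on_boundary_rot bd1.
have [ty0|ty0] := eqVneq (twist a b c d e f g y) 0.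
  exact: jac_gt0_on_planar_slice ty0 _ _ _ _.
have [tz0|tz0] := eqVneq (twist b c a e f d g z) 0.
  by rewrite jac_rot; exact: jac_gt0_on_planar_slice tz0 _ _ _ _.
have [tx0|tx0] := eqVneq (twist c a b f d e g x) 0.
  by rewrite 2!jac_rot; exact: jac_gt0_on_planar_slice tx0 _ _ _ _.
have [yz|yz] := ltP 0 (twist a b c d e f g y * twist b c a e f d g z).
  exact: jac_gt0_of_twists.
have [zx|zx] := ltP 0 (twist b c a e f d g z * twist c a b f d e g x).
  by rewrite jac_rot; exact: jac_gt0_of_twists.
rewrite 2!jac_rot; apply: jac_gt0_of_twists => //.
(* The product of the three pairwise products is a positive square. *)
have yz' : twist a b c d e f g y * twist b c a e f d g z < 0.
  by rewrite lt_neqAle yz mulf_neq0.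
have zx' : twist b c a e f d g z * twist c a b f d e g x < 0.
  by rewrite lt_neqAle zx mulf_neq0.
have : 0 < twist a b c d e f g y * twist b c a e f d g z
    * (twist b c a e f d g z * twist c a b f d e g x) by rewrite nmulr_lgt0.
rewrite (_ : _ * _ = twist c a b f d e g x * twist a b c d e f g y
  * twist b c a e f d g z ^+ 2); last by ring.
by rewrite pmulr_lgt0 // exprn_even_gt0.
Qed.

(** * The Jacobian determinant of a trilinear map as a polynomial *)

Lemma derive_affine (V W : normedModType R) (F : V -> W) (p v : V) (w : W) :
  (forall h : R, F (h *: v + p) = F p + h *: w) -> 'D_v F p = w.
Proof.
move=> H; rewrite /derive; apply: cvg_lim => //.
apply: (@cvg_trans _ ((fun=> w) @ 0^')); last exact: cvg_cst.
apply: near_eq_cvg; near=> h.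
rewrite /= H addrC addKr scalerA mulVf ?scale1r //.
near: h; exact: nbhs_dnbhs_neq.
Unshelve. all: by end_near. Qed.

Lemma trilinear_jac (F : 'rV[R]_3 -> 'rV[R]_3) : trilinear F ->
  exists a b c d e f g : 'rV[R]_3,
    forall p, Jdet F p = jac a b c d e f g (p 0 0) (p 0 1) (p 0 2).
Proof.
move=> [C FE].
have FE' q : F q = C 0 0 0 + q 0 0 *: C 1 0 0 + q 0 1 *: C 0 1 0
    + q 0 2 *: C 0 0 1 + (q 0 1 * q 0 2) *: C 0 1 1 + (q 0 0 * q 0 2) *: C 1 0 1
    + (q 0 0 * q 0 1) *: C 1 1 0 + (q 0 0 * q 0 1 * q 0 2) *: C 1 1 1.
  have l1 : lift ord0 ord0 = 1 :> 'I_2 by exact: val_inj.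
  rewrite FE !big_ord_recl !big_ord0 l1 /= /bump /= !expr0 !expr1.
  by apply/rowP => i; rewrite !mxE; ring.
exists (C 1 0 0), (C 0 1 0), (C 0 0 1), (C 0 1 1), (C 1 0 1), (C 1 1 0), (C 1 1 1).
move=> p.
have dF : differentiable F p.
  rewrite (funext FE').
  have dx i := @differentiable_coord R 1 3 p 0 i.
  do 7! (apply: differentiableD; last by
    apply: differentiableZl; do ?apply: differentiableM; exact: dx).
  exact: differentiable_cst.
have rowJ i : row i ('J F p) = 'D_(delta_mx 0 i) F p.
  by rewrite rowE deriveEjacobian.
rewrite /Jdet /DF det_tr det_triple !rowJ /jac.
(* A trilinear map is affine along each axis, so each partial derivative is the coefficient of
   [h]. *)
by congr triple; apply: derive_affine => h; rewrite !FE' /bilin;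
  apply/rowP => i; rewrite !mxE /=; ring.
Qed.

End Analysis.

Theorem theorem1 (R : realType) (F : 'rV[R]_3 -> 'rV[R]_3)
    (trilinF : trilinear F)
    (Jpos : forall p : 'rV[R]_3, cube_boundary p -> 0 < Jdet F p) :
  valid_hexahedron F.
Proof.
have [a [b [c [d [e [f [g JE]]]]]]] := trilinear_jac trilinF.
move=> p cp; rewrite JE; apply: jac_gt0 => // x y z hx hy hz bdry.
pose q : 'rV[R]_3 := \row_i tnth [tuple x; y; z] i.
have qE : (q 0 0 = x) * (q 0 1 = y) * (q 0 2 = z) by rewrite !mxE.
have := Jpos q; rewrite JE !qE; apply; split.
  by case=> [[|[|[|//]]] ?]; rewrite mxE (tnth_nth 0).
move/eqP: bdry; rewrite !mulf_eq0 !subr_eq0.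
(* The vanishing factor determines which of the six faces contains [q]. *)
move=> /orP[/orP[]|] /orP[] /eqP E; [exists 0|exists 0|exists 1|exists 1
  |exists 2|exists 2]; by rewrite qE ?E; auto.
Qed.
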